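(* Let $A\in\mathcal{M}(3,\mathbb{H})$ be a $3\times3$ quaternionic matrix with some zero entry outside the diagonal. Then there exists a polynomial characteristic function $\mu$ of $A$ such that $\mu(A)=0$.
   Context: $\mathbb{H}$ is the algebra of quaternions with norm $\vert\cdot\vert$ and $\mathcal{M}(n,\mathbb{H})$ is the set of $n\times n$ quaternionic matrices, $I$ the identity matrix. Study's determinant: write $A=X+jY$ with $X,Y\in\mathcal{M}(n,\mathbb{C})$ and let $c(A)=\begin{bmatrix}X&-\overline{Y}\\ Y&\overline{X}\end{bmatrix}\in\mathcal{M}(2n,\mathbb{C})$; then $\det c(A)\ge 0$ and $\mathrm{Sdet}(A)=(\det c(A))^{1/2}$. A map $\mu\colon\mathbb{H}\to\mathbb{H}$ is a characteristic function of $A$ if, up to a constant, $\vert\mu(\lambda)\vert=\mathrm{Sdet}(A-\lambda I)$ for all $\lambda\in\mathbb{H}$; i.e. there is a real constant $k>0$ with $\vert\mu(\lambda)\vert=k\,\mathrm{Sdet}(A-\lambda I)$ for all $\lambda$. A quaternionic polynomial is a formal finite sum of monomials $q_1\lambda q_2\lambda\cdots q_k\lambda q_{k+1}$ with quaternionic coefficients (constants are allowed); it defines a function on $\mathbb{H}$. A characteristic function is polynomial if it is the function defined by such an expression, and $\mu(A)$ is the matrix obtained from the expression by replacing $\lambda$ by $A$ and each quaternion $q$ by $qI$. *)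

(* Defs.v *)
From HB Require Import structures.
From mathcomp Require Import all_boot all_order all_algebra.
From mathcomp Require Import complex ring.

Set Implicit Arguments.
Unset Strict Implicit.
Unset Printing Implicit Defensive.

Import Order.TTheory GRing.Theory Num.Theory.
Local Open Scope ring_scope.

(* [Quat a b c d] is a + b i + c j + d k. *)
Record quat (R : Type) : Type := Quat { qre : R; qi : R; qj : R; qk : R }.

Section QuatRing.
Variable R : rcfType.
Implicit Types p q : quat R.

Definition quat_to_prod q := (qre q, qi q, qj q, qk q).
Definition quat_of_prod (x : R * R * R * R) : quat R :=
  let: (a, b, c, d) := x in Quat a b c d.
Lemma quat_to_prodK : cancel quat_to_prod quat_of_prod.
Proof. by case. Qed.

HB.instance Definition _ := Choice.copy (quat R) (can_type quat_to_prodK).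

Definition quat_add p q : quat R :=
  Quat (qre p + qre q) (qi p + qi q) (qj p + qj q) (qk p + qk q).
Definition quat_opp q : quat R := Quat (- qre q) (- qi q) (- qj q) (- qk q).
Definition quat_mul p q : quat R :=
  Quat (qre p * qre q - qi p * qi q - qj p * qj q - qk p * qk q)
       (qre p * qi q + qi p * qre q + qj p * qk q - qk p * qj q)
       (qre p * qj q - qi p * qk q + qj p * qre q + qk p * qi q)
       (qre p * qk q + qi p * qj q - qj p * qi q + qk p * qre q).

Lemma quat_addA : associative quat_add.
Proof. by move=> p q r; rewrite /quat_add /= !addrA. Qed.
Lemma quat_addC : commutative quat_add.
Proof. by move=> p q; congr Quat; rewrite addrC. Qed.
Lemma quat_add0 : left_id (Quat 0 0 0 0) quat_add.
Proof. by case=> *; rewrite /quat_add /= !add0r. Qed.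
Lemma quat_addN : left_inverse (Quat 0 0 0 0) quat_opp quat_add.
Proof. by move=> q; rewrite /quat_add /= !addNr. Qed.

HB.instance Definition _ :=
  GRing.isZmodule.Build (quat R) quat_addA quat_addC quat_add0 quat_addN.

Lemma quat_mulA : associative quat_mul.
Proof. by move=> [????] [????] [????]; congr Quat => /=; ring. Qed.
Lemma quat_mul1l : left_id (Quat 1 0 0 0) quat_mul.
Proof. by move=> [????]; congr Quat => /=; ring. Qed.
Lemma quat_mul1r : right_id (Quat 1 0 0 0) quat_mul.
Proof. by move=> [????]; congr Quat => /=; ring. Qed.
Lemma quat_mulDl : left_distributive quat_mul quat_add.
Proof. by move=> [????] [????] [????]; congr Quat => /=; ring. Qed.
Lemma quat_mulDr : right_distributive quat_mul quat_add.
Proof. by move=> [????] [????] [????]; congr Quat => /=; ring. Qed.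
Lemma quat_oner_neq0 : Quat 1 0 0 0 != 0 :> quat R.
Proof. by apply/eqP => -[] /eqP; rewrite oner_eq0. Qed.

HB.instance Definition _ :=
  GRing.Zmodule_isNzRing.Build (quat R) quat_mulA quat_mul1l quat_mul1r
    quat_mulDl quat_mulDr quat_oner_neq0.

Definition quat_norm q : R :=
  Num.sqrt (qre q ^+ 2 + qi q ^+ 2 + qj q ^+ 2 + qk q ^+ 2).

Definition quat_of_complex (z : R[i]) : quat R :=
  Quat (complex.Re z) (complex.Im z) 0 0.

(* q = x + j y with x, y complex: since j i = - k, the second component of
   a + b i + c j + d k is c - d i; see [quat_decomp]. *)
Definition quat_X q : R[i] := Complex (qre q) (qi q).
Definition quat_Y q : R[i] := Complex (qj q) (- qk q).

Lemma quat_decomp q :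
  q = quat_of_complex (quat_X q) + Quat 0 0 1 0 * quat_of_complex (quat_Y q).
Proof. by case: q => a b c d; congr Quat => /=; ring. Qed.

End QuatRing.

Section Study.
Variables (R : rcfType) (n : nat).
Implicit Types A : 'M[quat R]_n.

Definition study_mx A : 'M[R[i]]_(n + n) :=
  let X := map_mx (@quat_X R) A in
  let Y := map_mx (@quat_Y R) A in
  block_mx X (- map_mx Num.conj Y) Y (map_mx Num.conj X).

(* Valued in R[i], like the norm of a numClosedFieldType: [sqrtC z] is the
   nonnegative square root of z when 0 <= z, which holds for \det (study_mx A). *)
Definition Sdet A : R[i] := sqrtC (\det (study_mx A)).

Definition characteristic_function (mu : quat R -> quat R) A : Prop :=
  exists2 k : R, 0 < k &
    forall lambda : quat R,
      (quat_norm (mu lambda))%:C%C = k%:C%C * Sdet (A - lambda%:M).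

End Study.

(* The pair (q1, [:: q2; ...; q(k+1)]) stands for q1 X q2 X ... X q(k+1),
   a polynomial being the formal sum of a list of such monomials. *)
Definition quat_monomial (R : Type) := (quat R * seq (quat R))%type.
Definition quat_poly (R : Type) := seq (quat_monomial R).

Section Evaluation.
Variables (R : rcfType) (B : pzRingType) (f : quat R -> B) (x : B).

Definition eval_quat_monomial (m : quat_monomial R) : B :=
  foldl (fun acc q => acc * x * f q) (f m.1) m.2.

Definition eval_quat_poly (P : quat_poly R) : B := \sum_(m <- P) eval_quat_monomial m.

End Evaluation.

Definition quat_poly_fun (R : rcfType) (P : quat_poly R) (lambda : quat R) : quat R :=
  eval_quat_poly id lambda P.

Definition quat_poly_mx (R : rcfType) (n : nat) (P : quat_poly R) (A : 'M[quat R]_n) :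
    'M[quat R]_n :=
  eval_quat_poly (fun q => q%:M) A P.

(* Main.v *)
(* Conjugating by a permutation, assume that the entry (0, 2) of A vanishes, and write
   the rows of A as (a, b, 0), (d, e, f), (g, h, i). If b and f are nonzero, eliminating
   the first column of A - x with the help of the other two leaves the entry
   mu x = g + h v(x) + (i - x) w(x), where b v(x) = x - a and f w(x) = (x - e) v(x) - d;
   hence Sdet (A - x) = |b| |f| |mu x|, and mu is polynomial because b and f are constant.
   That mu(A) = 0 is checked row by row, using that q%:M acts on the unit row vectors as
   the scalar q. When b or f vanishes, A is block triangular and mu is the product, in a
   suitable order, of characteristic functions of the diagonal blocks. *)
Require Import Defs.
From HB Require Import structures.
From mathcomp Require Import all_boot all_order all_fingroup all_algebra.
From mathcomp Require Import reals complex ring.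
Set Implicit Arguments.
Unset Strict Implicit.
Unset Printing Implicit Defensive.
Import Order.TTheory GRing.Theory Num.Theory.
Local Open Scope ring_scope.

(** The same permutation acts on rows and columns, so the two signs cancel. The sizes are only
    propositionally equal because the use below compares [(m + m) + (n + n)] with
    [(m + n) + (m + n)]. *)
Lemma det_mxsub (R : comNzRingType) (m n : nat) (g : 'I_m -> 'I_n) (M : 'M[R]_n) :
  m = n -> injective g -> \det (mxsub g g M) = \det M.
Proof.
move=> emn; case: n / emn g M => g M g_inj; pose s := perm g_inj.
have ->: mxsub g g M = row_perm s (col_perm s M).
  by apply/matrixP => i j; rewrite !mxE !permE.
rewrite row_permE col_permE !det_mulmx !det_perm odd_permV mulrCA.
by rewrite -signr_addb addbb mulr1.
Qed.

(* Exchanges the two middle blocks of indices, so that the Study matrix of a block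
   triangular matrix becomes block triangular. *)
Definition ord_swap (p q r s : nat) (u : 'I_((p + q) + (r + s))) :
    'I_((p + r) + (q + s)) :=
  match split u with
  | inl v => match split v with
             | inl i => lshift _ (lshift _ i) | inr i => rshift _ (lshift _ i)
             end
  | inr v => match split v with
             | inl i => lshift _ (rshift _ i) | inr i => rshift _ (rshift _ i)
             end
  end.

Lemma split_lshift (m n : nat) (i : 'I_m) : split (lshift n i) = inl i.
Proof. exact: (unsplitK (inl i)). Qed.

Lemma split_rshift (m n : nat) (i : 'I_n) : split (rshift m i) = inr i.
Proof. exact: (unsplitK (inr i)). Qed.

Definition split_shiftE := (split_lshift, split_rshift).

Lemma ord_swapK (p q r s : nat) : cancel (@ord_swap p q r s) (@ord_swap p r q s).
Proof.
move=> u; rewrite -[u]splitK; case: (split u) => v /=;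
  rewrite -[v]splitK; case: (split v) => i /=; by rewrite /ord_swap !split_shiftE.
Qed.

(** * Multiplicativity of Study's determinant and its value on triangular matrices *)

Section Study.
Variable R : rcfType.
Implicit Types p q : quat R.

Definition sqnorm q : R := qre q ^+ 2 + qi q ^+ 2 + qj q ^+ 2 + qk q ^+ 2.

Lemma sqnormM p q : sqnorm (p * q) = sqnorm p * sqnorm q.
Proof. by case: p q => [????] [????]; rewrite /sqnorm /=; ring. Qed.

Lemma sqnorm_ge0 q : 0 <= sqnorm q.
Proof. by rewrite !addr_ge0 ?sqr_ge0. Qed.

Lemma sqnorm_gt0 q : q != 0 -> 0 < sqnorm q.
Proof.
move=> q0; rewrite lt_def sqnorm_ge0 andbT; apply: contraNneq q0 => /eqP.
rewrite /sqnorm !paddr_eq0 ?addr_ge0 ?sqr_ge0 // !sqrf_eq0.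
by case: q => a b c d /= /andP[/andP[/andP[/eqP-> /eqP->] /eqP->] /eqP->].
Qed.

Lemma quat_inv q : q != 0 -> exists2 q', q * q' = 1 & q' * q = 1.
Proof.
move=> /sqnorm_gt0; case: q => a b c d; rewrite /sqnorm /= => N0.
have := gt_eqF N0; set N := (X in X == 0) => /eqP Nn0.
exists (Quat (a / N) (- b / N) (- c / N) (- d / N)); congr Quat => /=;
  rewrite /N; field; exact/eqP.
Qed.

Fact quat_X_is_nmod : nmod_morphism (@quat_X R).
Proof. by split=> [|[????] [????]]. Qed.
HB.instance Definition _ := GRing.isNmodMorphism.Build _ _ (@quat_X R) quat_X_is_nmod.

Fact quat_Y_is_nmod : nmod_morphism (@quat_Y R).
Proof.
by split=> [|[????] [????]]; apply/eqP; rewrite eq_complex /= ?oppr0 ?opprD !eqxx.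
Qed.
HB.instance Definition _ := GRing.isNmodMorphism.Build _ _ (@quat_Y R) quat_Y_is_nmod.

Lemma conjE (z : R[i]) : z^* = conjc z.
Proof. by []. Qed.

(** Expand [(x + j y) (x' + j y')] using [z j = j z^*] for complex [z], and [j^2 = -1]; [quat_YM] is
    the other component. *)
Lemma quat_XM p q :
  quat_X (p * q) = quat_X p * quat_X q - (quat_Y p)^* * quat_Y q.
Proof.
case: p q => [????] [????]; rewrite conjE; apply/eqP; rewrite eq_complex /=.
by apply/andP; split; apply/eqP; ring.
Qed.

Lemma quat_YM p q :
  quat_Y (p * q) = quat_Y p * quat_X q + (quat_X p)^* * quat_Y q.
Proof.
case: p q => [????] [????]; rewrite conjE; apply/eqP; rewrite eq_complex /=.
by apply/andP; split; apply/eqP; ring.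
Qed.

Lemma study_mxM (n : nat) (A B : 'M[quat R]_n) :
  study_mx (A *m B) = study_mx A *m study_mx B.
Proof.
rewrite /study_mx mulmx_block; congr block_mx; apply/matrixP => i j;
  rewrite !mxE ?raddf_sum -?(sumrN, big_split) /=; apply: eq_bigr => k _; rewrite !mxE.
- by rewrite quat_XM mulNr.
- by rewrite quat_YM rmorphD !rmorphM /= conjCK opprD mulrN mulNr addrC.
- by rewrite quat_YM.
- by rewrite quat_XM rmorphB !rmorphM /= conjCK mulrN addrC.
Qed.

Lemma study_mx_perm (n : nat) (s : 'S_n) :
  study_mx (perm_mx s : 'M[quat R]_n) = block_mx (perm_mx s) 0 0 (perm_mx s).
Proof.
rewrite /study_mx; congr block_mx; apply/matrixP => i j; rewrite !mxE.
all: by case: (_ == _) => /=; apply/eqP; rewrite ?eq_complex /= ?oppr0 ?eqxx.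
Qed.

(* The square of Study's determinant, [Sdet A = sqrtC (sdet2 A)]. *)
Definition sdet2 (n : nat) (A : 'M[quat R]_n) : R[i] := \det (study_mx A).

Lemma sdet2M (n : nat) (A B : 'M[quat R]_n) : sdet2 (A *m B) = sdet2 A * sdet2 B.
Proof. by rewrite /sdet2 study_mxM det_mulmx. Qed.

Lemma sdet2_perm (n : nat) (s : 'S_n) : sdet2 (perm_mx s) = 1.
Proof. by rewrite /sdet2 study_mx_perm det_ublock det_perm -signr_addb addbb. Qed.

Lemma sdet2_lblock (m n : nat) (A : 'M[quat R]_m) (C : 'M_(n, m)) (D : 'M_n) :
  sdet2 (block_mx A 0 C D) = sdet2 A * sdet2 D.
Proof.
rewrite /sdet2 -(det_mxsub (study_mx _) (addnACA m m n n) (can_inj (@ord_swapK m m n n))).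
(* The off-diagonal block is the Study matrix of the rectangular [C], written out because [study_mx]
   takes square matrices. *)
rewrite -(det_lblock (study_mx A) (block_mx (map_mx (@quat_X R) C)
   (- map_mx Num.conj (map_mx (@quat_Y R) C)) (map_mx (@quat_Y R) C)
    (map_mx Num.conj (map_mx (@quat_X R) C)))); congr (\det _).
apply/matrixP => x y; rewrite mxE.
rewrite -[x]splitK -[y]splitK; case: (split x) => u; case: (split y) => v /=;
rewrite -[u]splitK -[v]splitK; case: (split u) => a; case: (split v) => b /=.
all: rewrite /ord_swap !split_shiftE /study_mx.
all: by rewrite ?(block_mxEul, block_mxEur, block_mxEdl, block_mxEdr, mxE, raddf0, oppr0).
Qed.

Lemma sdet2_mx11 (a : 'M[quat R]_1) : sdet2 a = (sqnorm (a 0 0))%:C%C.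
Proof.
rewrite /sdet2 (expand_det_row _ (lshift 1 0)) /cofactor big_split_ord !big_ord1 /=.
have e1 : @lift (1 + 1) (lshift 1 0) (0 : 'I_1) = rshift 1 0 by apply: val_inj.
have e2 : @lift (1 + 1) (rshift 1 0) (0 : 'I_1) = lshift 1 0 by apply: val_inj.
have rc (M : 'M[R[i]]_(1 + 1)) r c x y :
  row' r (col' c M) x y = M (lift r x) (lift c y) by rewrite !mxE.
rewrite !det_mx11 !rc !ord1 e1 e2.
rewrite /study_mx block_mxEul block_mxEur block_mxEdl block_mxEdr !mxE.
rewrite !conjE /sqnorm; apply/eqP; rewrite eq_complex /=.
case: (a 0 0) => x y z t /=.
by apply/andP; split; apply/eqP; rewrite ?(expr0, expr1) /=; ring.
Qed.

Lemma sdet2_trig (n : nat) (A : 'M[quat R]_n) : is_trig_mx A ->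
  sdet2 A = (\prod_i sqnorm (A i i))%:C%C.
Proof.
move=> tA; elim/trigsqmx_ind: n A / tA => [|n x c A tA IH].
  by rewrite big_ord0 /sdet2 det_mx00.
rewrite sdet2_lblock sdet2_mx11 IH -rmorphM big_split_ord big_ord1 /= block_mxEul.
by under [in RHS]eq_bigr => i _ do rewrite block_mxEdr.
Qed.
End Study.

(** * Ring operations on formal quaternionic polynomials *)

Section Polynomials.
Variable R : rcfType.
Implicit Types (m : quat_monomial R) (P Q : quat_poly R).

(** Concatenates two words in [X], merging the last coefficient of the first with the leading one of
    the second. The list [s] is never empty, so the default of [head] is not reached. *)
Definition monomial_mul m m' : quat_monomial R :=
  let s := rcons (belast m.1 m.2) (last m.1 m.2 * m'.1) in
  (head 0 s, behead s ++ m'.2).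

Definition poly_opp P : quat_poly R := [seq (- m.1, m.2) | m <- P].

Definition poly_mul P Q : quat_poly R := [seq monomial_mul m m' | m <- P, m' <- Q].

Section Eval.
Variables (B : pzRingType) (f : quat R -> B) (x : B).
Hypotheses (fN : {morph f : q / - q}) (fM : {morph f : p q / p * q}).
Let step acc q := acc * x * f q.

Lemma foldl_step_mull (y z : B) s : foldl step (y * z) s = y * foldl step z s.
Proof. by elim: s z => //= q s IHs z; rewrite -IHs /step !mulrA. Qed.

Lemma eval_monomial_mul m m' :
  eval_quat_monomial f x (monomial_mul m m')
  = eval_quat_monomial f x m * eval_quat_monomial f x m'.
Proof.
case: m m' => q s [q' s']; rewrite /eval_quat_monomial /monomial_mul /= -/step.
case/lastP: s => [|s l] /=; first by rewrite fM foldl_step_mull.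
rewrite belast_rcons last_rcons /= foldl_cat foldl_rcons foldl_rcons -foldl_step_mull.
by rewrite {2 4}/step fM !mulrA.
Qed.

Lemma eval_quat_poly_add P Q :
  eval_quat_poly f x (P ++ Q) = eval_quat_poly f x P + eval_quat_poly f x Q.
Proof. exact: big_cat. Qed.

Lemma eval_quat_poly_opp P : eval_quat_poly f x (poly_opp P) = - eval_quat_poly f x P.
Proof.
rewrite /eval_quat_poly big_map -sumrN; apply: eq_bigr => m _.
by rewrite /eval_quat_monomial /= fN -mulN1r foldl_step_mull mulN1r.
Qed.

Lemma eval_quat_poly_mul P Q :
  eval_quat_poly f x (poly_mul P Q) = eval_quat_poly f x P * eval_quat_poly f x Q.
Proof.
rewrite /eval_quat_poly big_allpairs_dep mulr_suml; apply: eq_bigr => m _.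
by rewrite mulr_sumr; apply: eq_bigr => m' _; rewrite eval_monomial_mul.
Qed.
End Eval.

Variables (n : nat) (A : 'M[quat R]_n.+1).

(* [mu] and [X] are the function and the matrix obtained from one and the same
   quaternionic polynomial. *)
Definition poly_values (mu : quat R -> quat R) (X : 'M[quat R]_n.+1) :=
  exists2 P, quat_poly_fun P =1 mu & quat_poly_mx P A = X.

Lemma poly_values_const q : poly_values (fun=> q) q%:M.
Proof.
by exists [:: (q, [::])] => [x|]; exact: big_seq1.
Qed.

Lemma poly_values_id : poly_values id A.
Proof.
by exists [:: (1, [:: 1])] => [x|];
  rewrite [LHS]big_seq1 /eval_quat_monomial /= mul1r mulr1.
Qed.

Lemma poly_values_opp mu X :
  poly_values mu X -> poly_values (fun x => - mu x) (- X).
Proof.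
case=> P Pmu PX; exists (poly_opp P) => [x|].
  by rewrite -Pmu /quat_poly_fun eval_quat_poly_opp.
by rewrite -PX /quat_poly_mx eval_quat_poly_opp // => q; rewrite raddfN.
Qed.

Lemma poly_values_add mu X nu Y :
  poly_values mu X -> poly_values nu Y -> poly_values (fun x => mu x + nu x) (X + Y).
Proof.
case=> P Pmu PX [Q Qnu QY]; exists (P ++ Q) => [x|].
  by rewrite -Pmu -Qnu /quat_poly_fun eval_quat_poly_add.
by rewrite -PX -QY /quat_poly_mx eval_quat_poly_add.
Qed.

Lemma poly_values_mul mu X nu Y :
  poly_values mu X -> poly_values nu Y -> poly_values (fun x => mu x * nu x) (X * Y).
Proof.
case=> P Pmu PX [Q Qnu QY]; exists (poly_mul P Q) => [x|].
  by rewrite -Pmu -Qnu /quat_poly_fun eval_quat_poly_mul.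
rewrite -PX -QY /quat_poly_mx eval_quat_poly_mul // => p q.
exact: scalar_mxM.
Qed.
End Polynomials.

(** * Invariance under permutation of the basis, and reduction to squared norms *)

Section Reindexing.
Variable R : rcfType.

Lemma eval_quat_poly_morph (B B' : pzRingType) (f : quat R -> B) (f' : quat R -> B')
    (phi : {additive B -> B'}) (x : B) (P : quat_poly R) :
  {morph phi : y z / y * z} -> phi \o f =1 f' ->
  phi (eval_quat_poly f x P) = eval_quat_poly f' (phi x) P.
Proof.
move=> phiM phif; rewrite /eval_quat_poly raddf_sum /=; apply: eq_bigr => -[q s] _.
rewrite /eval_quat_monomial /= -phif /=.
by elim: s (f q) => //= q' s IHs y; rewrite IHs !phiM -phif.
Qed.

Lemma mxsub_mul_perm (n : nat) (s : 'S_n) (A B : 'M[quat R]_n) :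
  mxsub s s (A *m B) = mxsub s s A *m mxsub s s B.
Proof.
apply/matrixP => x y; rewrite !mxE (reindex_inj (@perm_inj _ s)).
by apply: eq_bigr => k _; rewrite !mxE.
Qed.

Lemma mxsub_scalar_perm (n : nat) (s : 'S_n) (q : quat R) :
  mxsub s s q%:M = q%:M :> 'M_n.
Proof. by apply/matrixP => x y; rewrite !mxE (inj_eq perm_inj). Qed.

Lemma sdet2_mxsub_perm (n : nat) (s : 'S_n) (A : 'M[quat R]_n) :
  sdet2 (mxsub s s A) = sdet2 A.
Proof.
have ->: mxsub s s A = row_perm s (col_perm s A) by apply/matrixP => x y; rewrite !mxE.
by rewrite row_permE col_permE !sdet2M !sdet2_perm mul1r mulr1.
Qed.

Definition cayley_hamilton (n : nat) (A : 'M[quat R]_n.+1) : Prop :=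
  exists P : quat_poly R,
    characteristic_function (quat_poly_fun P) A /\ quat_poly_mx P A = 0.

(** Simultaneous permutation of rows and columns is multiplicative, fixes scalar matrices and
    preserves [sdet2], so one polynomial serves both matrices. *)
Lemma cayley_hamilton_mxsub (n : nat) (s : 'S_n.+1) (A : 'M[quat R]_n.+1) :
  cayley_hamilton (mxsub s s A) -> cayley_hamilton A.
Proof.
case=> P [[k k0 muk] PA]; exists P; split.
  exists k => // x; rewrite muk; congr (_ * sqrtC _).
  by rewrite -!/(sdet2 _) -[RHS](sdet2_mxsub_perm s) raddfB /= mxsub_scalar_perm.
have := eval_quat_poly_morph (f := fun q => q%:M) (f' := fun q => q%:M) (phi := mxsub s s)
  A P (@mxsub_mul_perm _ s) (mxsub_scalar_perm s).
rewrite -!/(quat_poly_mx _ _) PA => E; apply/matrixP => x y.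
have := congr1 (fun M : 'M[quat R]_n.+1 => M (s^-1 x) (s^-1 y))%g E.
by rewrite !mxE !permKV.
Qed.

Lemma sqrtC_real (x : R) : 0 <= x -> sqrtC x%:C%C = (Num.sqrt x)%:C%C.
Proof. by move=> x0; rewrite -{1}(sqr_sqrtr x0) rmorphXn /= sqrCK // ler0c sqrtr_ge0. Qed.

(** Taking square roots gives [Sdet (A - x) = sqrt c * |mu x|], whence the constant
    [k = 1 / sqrt c]. *)
Lemma cayley_hamilton_intro (n : nat) (A : 'M[quat R]_n.+1) mu (c : R) :
  0 < c -> (forall x, sdet2 (A - x%:M) = (c * sqnorm (mu x))%:C%C) ->
  poly_values A mu 0 -> cayley_hamilton A.
Proof.
move=> c0 Amu [P Pmu PA]; exists P; split => //.
have sc0 : Num.sqrt c != 0 by rewrite gt_eqF // sqrtr_gt0.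
exists (Num.sqrt c)^-1 => [|x]; first by rewrite invr_gt0 sqrtr_gt0.
rewrite Pmu /Sdet -/(sdet2 _) Amu sqrtC_real ?mulr_ge0 ?sqnorm_ge0 ?ltW //.
by rewrite sqrtrM ?ltW // -rmorphM /= mulKf.
Qed.

End Reindexing.

(** * Column operations on Study's determinant *)

Section Elimination.
Variables (R : rcfType) (n : nat).
Implicit Types M : 'M[quat R]_n.

(** Column operations have their coefficients on the right: they are right multiplication by the
    identity with column [k] replaced by [v]. The conditions on [v] make this factor lower
    triangular with unit diagonal. *)
Lemma sdet2_replace_col M (k : 'I_n) (v : 'I_n -> quat R) :
    v k = 1 -> (forall i : 'I_n, (i < k)%N -> v i = 0) ->
  sdet2 (\matrix_(i, j) (if j == k then \sum_l M i l * v l else M i j)) = sdet2 M.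
Proof.
move=> vk v0; pose V : 'M[quat R]_n :=
  \matrix_(i, j) (if j == k then v i else (i == j)%:R).
have -> : (\matrix_(i, j) (if j == k then \sum_l M i l * v l else M i j)) = M *m V.
  apply/matrixP => x y; rewrite !mxE; case: ifP => yk.
    by apply: eq_bigr => l _; rewrite mxE yk.
  rewrite (bigD1 y) //= mxE yk eqxx mulr1 big1 ?addr0 // => l ly.
  by rewrite mxE yk (negPf ly) mulr0.
have tV : is_trig_mx V.
  apply/is_trig_mxP => x y xy; rewrite mxE; case: eqP xy => [-> /v0 //|_ xy].
  by rewrite -val_eqE ltn_eqF.
rewrite sdet2M (sdet2_trig tV) big1 ?mulr1 // => x _; rewrite mxE eqxx.
by case: eqP => [->|_]; rewrite ?vk /sqnorm /=; ring.
Qed.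

Lemma sdet2_trig_perm M (s : 'S_n) : (forall i j : 'I_n, (i < j)%N -> M i (s j) = 0) ->
  sdet2 M = (\prod_i sqnorm (M i (s i)))%:C%C.
Proof.
move=> tM; have := @sdet2_trig _ _ (col_perm s M).
rewrite col_permE sdet2M sdet2_perm mulr1 -col_permE => ->.
  by under eq_bigr => i _ do rewrite mxE.
by apply/is_trig_mxP => x y /tM; rewrite mxE.
Qed.
End Elimination.

(** * Separation of quaternionic matrices by real additive forms *)

Section AdditiveForms.
Variable R : rcfType.

Fact qre_is_nmod : nmod_morphism (@qre R). Proof. by []. Qed.
Fact qi_is_nmod : nmod_morphism (@qi R). Proof. by []. Qed.
Fact qj_is_nmod : nmod_morphism (@qj R). Proof. by []. Qed.
Fact qk_is_nmod : nmod_morphism (@qk R). Proof. by []. Qed.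
HB.instance Definition _ := GRing.isNmodMorphism.Build _ _ (@qre R) qre_is_nmod.
HB.instance Definition _ := GRing.isNmodMorphism.Build _ _ (@qi R) qi_is_nmod.
HB.instance Definition _ := GRing.isNmodMorphism.Build _ _ (@qj R) qj_is_nmod.
HB.instance Definition _ := GRing.isNmodMorphism.Build _ _ (@qk R) qk_is_nmod.

(** The four real coordinates of each entry are additive forms, and together they determine the
    matrix. *)
Lemma additive_form_ext (m n : nat) (u v : 'M[quat R]_(m, n)) :
  (forall phi : {additive 'M[quat R]_(m, n) -> R}, phi u = phi v) -> u = v.
Proof.
move=> E; apply/matrixP => x y.
have coord_nmod : nmod_morphism (fun w : 'M[quat R]_(m, n) => w x y).
  by split=> [|? ?]; rewrite mxE.
pose C := GRing.isNmodMorphism.Build _ _ _ coord_nmod.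
pose c : {additive 'M[quat R]_(m, n) -> quat R} :=
  HB.pack (fun w : 'M[quat R]_(m, n) => w x y) C.
move: (E (@qre R \o c)) (E (@qi R \o c)) (E (@qj R \o c)) (E (@qk R \o c)) => /=.
by case: (u x y) (v x y) => [????] [????] /= -> -> -> ->.
Qed.
End AdditiveForms.

Lemma ord3P (P : 'I_3 -> Prop) : P 0 -> P 1 -> P 2%:R -> forall k, P k.
Proof.
by move=> P0 P1 P2 [[|[|[|//]]] ltk]; [move: P0|move: P1|move: P2];
  congr (P _); apply: val_inj.
Qed.

Lemma sum_ord3 (V : nmodType) (F : 'I_3 -> V) : \sum_i F i = F 0 + F 1 + F 2%:R.
Proof.
rewrite !big_ord_recl big_ord0 addr0 addrA; congr (_ + F _ + F _); exact: val_inj.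
Qed.

Lemma prod_ord3 (S : pzSemiRingType) (F : 'I_3 -> S) : \prod_i F i = F 0 * F 1 * F 2%:R.
Proof.
rewrite !big_ord_recl big_ord0 mulr1 mulrA; congr (_ * F _ * F _); exact: val_inj.
Qed.

(** * Unit rows under right multiplication by matrices *)

Section Rows.
Variable R : rcfType.

Definition unit_row (k : 'I_3) : 'rV[quat R]_3 := delta_mx 0 k.

(** The entries 0 and 1 are central, so here right multiplication by [q%:M] agrees with left
    scaling, which commutes with right multiplication by any matrix. For a general row this
    fails. *)
Lemma unit_row_scalar k q : unit_row k *m q%:M = q *: unit_row k.
Proof. by rewrite -rowE; apply/rowP => y; rewrite !mxE eqxx !mulr_natr eq_sym. Qed.

Lemma unit_row_mul k (A : 'M[quat R]_3) :
  unit_row k *m A = A k 0 *: unit_row 0 + A k 1 *: unit_row 1 + A k 2%:R *: unit_row 2%:R.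
Proof.
by rewrite -rowE [LHS]row_sum_delta sum_ord3 !mxE.
Qed.

Lemma unit_row_eq0 (A : 'M[quat R]_3) :
  unit_row 0 *m A = 0 -> unit_row 1 *m A = 0 -> unit_row 2%:R *m A = 0 -> A = 0.
Proof.
by rewrite -!rowE => E0 E1 E2; apply/row_matrixP; elim/ord3P; rewrite row0.
Qed.
End Rows.

(* Module identities with coefficients in [quat R] are tested by additive maps to the
   commutative ring [R], treating each scaled row as an atom, so that [ring] applies. *)
Ltac additive_ring := apply: additive_form_ext => phi; ring.

(** * Vanishing of [mu(A)] in each case *)

Section Cases.
Variables (R : rcfType) (A : 'M[quat R]_3).
Let a := A 0 0. Let b := A 0 1.
Let d := A 1 0. Let e := A 1 1. Let f := A 1 2%:R.
Let g := A 2%:R 0. Let h := A 2%:R 1. Let i := A 2%:R 2%:R.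
Let e0 : 'rV[quat R]_3 := unit_row R 0.
Let e1 : 'rV[quat R]_3 := unit_row R 1.
Let e2 : 'rV[quat R]_3 := unit_row R 2%:R.

Hypothesis A02 : A 0 2%:R = 0.

Lemma row0A : e0 *m A = a *: e0 + b *: e1.
Proof. by rewrite unit_row_mul A02 scale0r addr0. Qed.

Lemma row1A : e1 *m A = d *: e0 + e *: e1 + f *: e2.
Proof. exact: unit_row_mul. Qed.

Lemma row2A : e2 *m A = g *: e0 + h *: e1 + i *: e2.
Proof. exact: unit_row_mul. Qed.

Lemma scale_cancel (p p' : quat R) (u v : 'rV[quat R]_3) :
  p' * p = 1 -> p *: u = p *: v -> u = v.
Proof. by move=> pK E; rewrite -[u]scale1r -[v]scale1r -pK -!scalerA E. Qed.

Lemma row_solve p q (v : 'M[quat R]_3) k : p%:M * v = A - q%:M ->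
  p *: (unit_row R k *m v) = unit_row R k *m A - q *: unit_row R k.
Proof.
move=> E; rewrite scalemxAl -unit_row_scalar -mulmxA [p%:M *m v]E.
by rewrite mulmxBr unit_row_scalar.
Qed.

(* The rows [w k j = e_k *m v_j], with [v_0 = 1], [v_1 = v], [v_2 = w], satisfy
   [\sum_j A l j *: w k j = \sum_j A k j *: w j l] for [l < 2], and the same with the
   extra term [e_k *m S] on the right for [l = 2], where [S] is the matrix to be killed.
   Hence [S = 0] once [w k j] is symmetric in [k] and [j]. *)
Lemma annihilate_generic b' f' (v w : 'M[quat R]_3) :
  b' * b = 1 -> f' * f = 1 ->
  b%:M * v = A - a%:M -> f%:M * w = (A - e%:M) * v - d%:M ->
  g%:M + h%:M * v + (i%:M - A) * w = 0.
Proof.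
move=> bK fK Ev Ew.
have rowv k := row_solve k Ev.
have roww k : f *: (unit_row R k *m w) =
   unit_row R k *m A *m v - e *: (unit_row R k *m v) - d *: unit_row R k.
  rewrite scalemxAl -unit_row_scalar -mulmxA [f%:M *m w]Ew !(mulmxBr, mulmxA, mulmxBl).
  by rewrite !unit_row_scalar -!scalemxAl.
(* [e0] acts as a cyclic vector: row 0 of [A] recovers [e1] from it, and row 1 then recovers
   [e2]. *)
have w01 : e0 *m v = e1.
  by apply: (scale_cancel bK); rewrite rowv row0A addrC addKr.
have w02 : e0 *m w = e2.
  apply: (scale_cancel fK); rewrite roww row0A mulmxDl -!scalemxAl w01 rowv -/e1 row1A.
  additive_ring.
have w12 : e1 *m w = e2 *m v.
  apply: (scale_cancel fK); rewrite roww -/e1 row1A !mulmxDl -!scalemxAl w01; additive_ring.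
have rowS k : unit_row R k *m (g%:M + h%:M * v + (i%:M - A) * w) =
    g *: unit_row R k + h *: (unit_row R k *m v) + i *: (unit_row R k *m w)
    - unit_row R k *m A *m w.
  by rewrite !(mulmxDr, mulmxA, mulmxN, mulmxDl, mulNmx) !unit_row_scalar -!scalemxAl addrA.
(* By symmetry the rows of [S] are [g *: e0 + h *: e1 + i *: e2 - e2 *m A], which is zero,
   multiplied on the right by [1], [v] and [w]. *)
apply: unit_row_eq0; rewrite rowS -/e0 -/e1 -/e2.
- rewrite row0A mulmxDl -!scalemxAl w01 w02 w12 rowv -/e2 row2A; additive_ring.
- rewrite row1A !mulmxDl -!scalemxAl w02 roww -/e2 row2A !mulmxDl -!scalemxAl w01 w12.
  additive_ring.
by rewrite row2A !mulmxDl -!scalemxAl w02 w12; additive_ring.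
Qed.

(** The factor [a%:M - A] kills [e0]. Placed last, it lets rows be computed modulo [e0], where [A]
    acts by its lower 2x2 block and [v] sends [e1] to [e2]. *)
Lemma annihilate_lblock12 f' (v : 'M[quat R]_3) :
  b = 0 -> f' * f = 1 -> f%:M * v = A - e%:M ->
  (h%:M + (i%:M - A) * v) * (a%:M - A) = 0.
Proof.
move=> b0 fK Ev; have rowv k := row_solve k Ev.
have row0 : e0 *m A = a *: e0 by rewrite row0A b0 scale0r addr0.
move defN: (a%:M - A) => N.
have N0 : e0 *m N = 0 by rewrite -defN mulmxBr unit_row_scalar row0 subrr.
have z0 : e0 *m v *m N = 0.
  apply: (scale_cancel fK).
  by rewrite scalemxAl rowv row0 mulmxBl -!scalemxAl N0 !scaler0 subrr.
have z1 : e1 *m v *m N = e2 *m N.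
  apply: (scale_cancel fK).
  rewrite scalemxAl rowv -/e1 row1A !(mulmxDl, mulNmx) -!scalemxAl N0 scaler0; additive_ring.
have z2 : f *: (e2 *m v *m N) =
    g *: (e0 *m N) + h *: (e1 *m N) + (i *: (e2 *m N) - e *: (e2 *m N)).
  by rewrite scalemxAl rowv -/e2 row2A !(mulmxDl, mulNmx) -!scalemxAl addrA.
have rowS k : unit_row R k *m ((h%:M + (i%:M - A) * v) * N) =
    h *: (unit_row R k *m N) + i *: (unit_row R k *m v *m N)
    - unit_row R k *m A *m v *m N.
  by rewrite !(mulmxDr, mulmxA, mulmxN, mulmxDl, mulNmx) !unit_row_scalar -!scalemxAl addrA.
apply: unit_row_eq0; rewrite rowS -/e0 -/e1 -/e2.
- by rewrite row0 -!scalemxAl z0 N0 !scaler0 addr0 subrr.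
- rewrite row1A !mulmxDl -!scalemxAl z0 z1 z2 N0 !scaler0; additive_ring.
by rewrite row2A !mulmxDl -!scalemxAl z0 z1 scaler0; additive_ring.
Qed.

(** Modulo [e0], the first factor kills [e1] and the second kills [e2]; the last factor kills [e0]
    itself. *)
Lemma annihilate_trig : b = 0 -> f = 0 -> h = 0 ->
  (e%:M - A) * (i%:M - A) * (a%:M - A) = 0.
Proof.
move=> b0 f0 h0.
have row0 : e0 *m A = a *: e0 by rewrite row0A b0 scale0r addr0.
have row1 : e1 *m A = d *: e0 + e *: e1 by rewrite row1A f0 scale0r addr0.
have row2 : e2 *m A = g *: e0 + i *: e2 by rewrite row2A h0 scale0r addr0.
move defN: (a%:M - A) => N.
have N0 : e0 *m N = 0 by rewrite -defN mulmxBr unit_row_scalar row0 subrr.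
have rowS k : unit_row R k *m ((e%:M - A) * (i%:M - A) * N) =
    e *: (i *: (unit_row R k *m N)) - e *: (unit_row R k *m A *m N)
    - (unit_row R k *m A *m i%:M *m N - unit_row R k *m A *m A *m N).
  rewrite !(mulmxBr, mulmxA, mulmxBl, mulNmx) !unit_row_scalar -!scalemxAl !unit_row_scalar.
  by rewrite -!scalemxAl; additive_ring.
apply: unit_row_eq0; rewrite rowS -/e0 -/e1 -/e2.
- by rewrite !(row0, =^~ scalemxAl, unit_row_scalar) N0 !scaler0 !subr0.
- rewrite !(row0, row1, mulmxDl, =^~ scalemxAl, unit_row_scalar, scalerDr) -/e1 N0 !scaler0.
  additive_ring.
rewrite !(row0, row2, mulmxDl, =^~ scalemxAl, unit_row_scalar, scalerDr) -/e2 N0 !scaler0.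
additive_ring.
Qed.

(** The second factor [T] belongs to the upper 2x2 block and kills [e0] and [e1], while [i%:M - A]
    sends every row into their span: hence this order. *)
Lemma annihilate_lblock21 b' (v : 'M[quat R]_3) :
  f = 0 -> b' * b = 1 -> b%:M * v = A - a%:M ->
  (i%:M - A) * (d%:M + (e%:M - A) * v) = 0.
Proof.
move=> f0 bK Ev; have rowv k := row_solve k Ev.
have row1 : e1 *m A = d *: e0 + e *: e1 by rewrite row1A f0 scale0r addr0.
move defT: (d%:M + (e%:M - A) * v) => T.
have w01 : e0 *m v = e1.
  by apply: (scale_cancel bK); rewrite rowv row0A addrC addKr.
have rowT k : unit_row R k *m T =
    d *: unit_row R k + e *: (unit_row R k *m v) - unit_row R k *m A *m v.
  rewrite -defT !(mulmxDr, mulmxA, mulmxN, mulmxDl, mulNmx).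
  by rewrite !unit_row_scalar -!scalemxAl addrA.
have T0 : e0 *m T = 0.
  rewrite rowT row0A mulmxDl -!scalemxAl -/e0 w01 rowv -/e1 row1; additive_ring.
have T1 : e1 *m T = 0.
  rewrite rowT row1 mulmxDl -!scalemxAl -/e1 w01; additive_ring.
have rowS k : unit_row R k *m ((i%:M - A) * T) =
    i *: (unit_row R k *m T) - unit_row R k *m A *m T.
  by rewrite mulmxA mulmxBr mulmxBl unit_row_scalar -scalemxAl.
apply: unit_row_eq0; rewrite rowS -/e0 -/e1 -/e2.
- by rewrite row0A mulmxDl -!scalemxAl T0 T1 !scaler0 addr0 subrr.
- by rewrite row1 mulmxDl -!scalemxAl T0 T1 !scaler0 addr0 subrr.
by rewrite row2A !mulmxDl -!scalemxAl T0 T1 !scaler0 !add0r subrr.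
Qed.
End Cases.

(** * Study's determinant of a 3x3 matrix in each case *)

Section Determinants.
Variable R : rcfType.
Implicit Types (M : 'M[quat R]_3) (v w : quat R).

Lemma sdet2_trig_perm3 M (s : 'S_3) :
  M 0 (s 1) = 0 -> M 0 (s 2%:R) = 0 -> M 1 (s 2%:R) = 0 ->
  sdet2 M = (sqnorm (M 0 (s 0)) * sqnorm (M 1 (s 1)) * sqnorm (M 2%:R (s 2%:R)))%:C%C.
Proof.
move=> M01 M02 M12; rewrite (sdet2_trig_perm (s := s)) ?prod_ord3 //.
by do 2![elim/ord3P].
Qed.

Lemma sdet2_generic M v w :
  M 0 2%:R = 0 -> M 0 1 * v = - M 0 0 -> M 1 2%:R * w = - M 1 1 * v - M 1 0 ->
  sdet2 M = (sqnorm (M 0 1) * sqnorm (M 1 2%:R)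
             * sqnorm (M 2%:R 0 + M 2%:R 1 * v + M 2%:R 2%:R * w))%:C%C.
Proof.
(* Column 0 is replaced by the combination with coefficients [1, v, w], which vanishes in rows 0 and
   1; listing the columns as 1, 2, 0 then gives a lower triangular matrix. *)
move=> M02 Ev Ew; pose s : 'S_3 := mulg (tperm 0 1) (tperm 0 2%:R).
rewrite -(@sdet2_replace_col _ _ M 0 (fun k => nth 0 [:: 1; v; w] k)) //.
have [s0 s1 s2] : [/\ s 0 = 1, s 1 = 2%:R & s 2%:R = 0].
  by rewrite !permM !permE.
rewrite (sdet2_trig_perm3 (s := s)) ?(s0, s1, s2) !mxE //= sum_ord3 /= ?mulr1 //.
  by rewrite M02 mul0r addr0 Ev subrr.
by rewrite Ew mulNr -opprD addrC [_ * v + _]addrC addNr.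
Qed.

Lemma sdet2_lblock12 M v :
  M 0 1 = 0 -> M 0 2%:R = 0 -> M 1 2%:R * v = - M 1 1 ->
  sdet2 M = (sqnorm (M 0 0) * sqnorm (M 1 2%:R)
             * sqnorm (M 2%:R 1 + M 2%:R 2%:R * v))%:C%C.
Proof.
move=> M01 M02 Ev; pose s : 'S_3 := tperm 1 2%:R.
rewrite -(@sdet2_replace_col _ _ M 1 (fun k => nth 0 [:: 0; 1; v] k)) //; last first.
  by elim/ord3P.
have [s0 s1 s2] : [/\ s 0 = 0, s 1 = 2%:R & s 2%:R = 1] by rewrite !permE.
rewrite (sdet2_trig_perm3 (s := s)) ?(s0, s1, s2) !mxE //= sum_ord3 /= !mulr0 !mulr1 ?add0r //.
  by rewrite M01 M02 mul0r addr0.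
by rewrite Ev subrr.
Qed.

Lemma sdet2_lblock21 M v :
  M 0 2%:R = 0 -> M 1 2%:R = 0 -> M 0 1 * v = - M 0 0 ->
  sdet2 M = (sqnorm (M 0 1) * sqnorm (M 1 0 + M 1 1 * v)
             * sqnorm (M 2%:R 2%:R))%:C%C.
Proof.
move=> M02 M12 Ev; pose s : 'S_3 := tperm 0 1.
rewrite -(@sdet2_replace_col _ _ M 0 (fun k => nth 0 [:: 1; v; 0] k)) //.
have [s0 s1 s2] : [/\ s 0 = 1, s 1 = 0 & s 2%:R = 2%:R] by rewrite !permE.
rewrite (sdet2_trig_perm3 (s := s)) ?(s0, s1, s2) !mxE //= sum_ord3 /= !mulr0 !mulr1 ?addr0 //.
by rewrite Ev subrr.
Qed.
End Determinants.

Ltac solve_poly_values := repeat first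
  [ exact: poly_values_const | exact: poly_values_id | apply: poly_values_add
  | apply: poly_values_opp | apply: poly_values_mul ].

(** * Case analysis and conclusion *)

Section Main.
Variable R : rcfType.
Implicit Types A : 'M[quat R]_3.

Lemma cayley_hamilton_generic A :
  A 0 2%:R = 0 -> A 0 1 != 0 -> A 1 2%:R != 0 -> cayley_hamilton A.
Proof.
move=> A02 b0 f0; have [b' bK b'K] := quat_inv b0; have [f' fK f'K] := quat_inv f0.
pose v x := b' * (x - A 0 0); pose w x := f' * ((x - A 1 1) * v x - A 1 0).
pose vA := b'%:M * (A - (A 0 0)%:M).
pose wA := f'%:M * ((A - (A 1 1)%:M) * vA - (A 1 0)%:M).
apply: (@cayley_hamilton_intro _ _ _
  (fun x => A 2%:R 0 + A 2%:R 1 * v x + (A 2%:R 2%:R - x) * w x)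
  (sqnorm (A 0 1) * sqnorm (A 1 2%:R))); first by rewrite mulr_gt0 ?sqnorm_gt0.
  move=> x; rewrite (@sdet2_generic _ _ (v x) (w x)) !mxE /= ?subr0 //.
    by rewrite mulrA bK mul1r opprB.
  by rewrite mulrA fK mul1r opprB.
(* Writing 0 as the value of [mu] at [A] gives function and matrix the same shape, so [poly_values]
   follows by structural rules. *)
have <- : (A 2%:R 0)%:M + (A 2%:R 1)%:M * vA + ((A 2%:R 2%:R)%:M - A) * wA = 0.
  apply: (annihilate_generic A02 b'K f'K).
    by rewrite mulrA -rmorphM bK mul1r.
  by rewrite mulrA -rmorphM fK mul1r.
by rewrite /w /v /wA /vA; solve_poly_values.
Qed.

Lemma cayley_hamilton_lblock12 A :
  A 0 1 = 0 -> A 0 2%:R = 0 -> A 1 2%:R != 0 -> cayley_hamilton A.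
Proof.
move=> A01 A02 f0; have [f' fK f'K] := quat_inv f0.
pose v x := f' * (x - A 1 1); pose vA := f'%:M * (A - (A 1 1)%:M).
apply: (@cayley_hamilton_intro _ _ _
  (fun x => (A 2%:R 1 + (A 2%:R 2%:R - x) * v x) * (A 0 0 - x))
  (sqnorm (A 1 2%:R))); first by rewrite sqnorm_gt0.
  move=> x; rewrite (@sdet2_lblock12 _ _ (v x)) !mxE /= ?subr0 //.
    by rewrite sqnormM; congr (_%:C%C); ring.
  by rewrite mulrA fK mul1r opprB.
rewrite -(@annihilate_lblock12 _ _ A02 _ vA A01 f'K); last first.
  by rewrite mulrA -rmorphM fK mul1r.
by rewrite /v /vA; solve_poly_values.
Qed.

Lemma cayley_hamilton_lblock21 A :
  A 0 2%:R = 0 -> A 1 2%:R = 0 -> A 0 1 != 0 -> cayley_hamilton A.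
Proof.
move=> A02 A12 b0; have [b' bK b'K] := quat_inv b0.
pose v x := b' * (x - A 0 0); pose vA := b'%:M * (A - (A 0 0)%:M).
apply: (@cayley_hamilton_intro _ _ _
  (fun x => (A 2%:R 2%:R - x) * (A 1 0 + (A 1 1 - x) * v x))
  (sqnorm (A 0 1))); first by rewrite sqnorm_gt0.
  move=> x; rewrite (@sdet2_lblock21 _ _ (v x)) !mxE /= ?subr0 //.
    by rewrite sqnormM; congr (_%:C%C); ring.
  by rewrite mulrA bK mul1r opprB.
rewrite -(@annihilate_lblock21 _ _ A02 _ vA A12 b'K); last first.
  by rewrite mulrA -rmorphM bK mul1r.
by rewrite /v /vA; solve_poly_values.
Qed.

Lemma cayley_hamilton_trig A :
  A 0 1 = 0 -> A 0 2%:R = 0 -> A 1 2%:R = 0 -> A 2%:R 1 = 0 -> cayley_hamilton A.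
Proof.
move=> A01 A02 A12 A21.
apply: (@cayley_hamilton_intro _ _ _
  (fun x => (A 1 1 - x) * (A 2%:R 2%:R - x) * (A 0 0 - x)) 1) => //.
  move=> x; rewrite (@sdet2_trig_perm3 _ _ 1%g) !perm1 !mxE /= ?subr0 //.
  by rewrite !sqnormM; congr (_%:C%C); ring.
by rewrite -(annihilate_trig A02 A01 A12 A21); solve_poly_values.
Qed.

Lemma cayley_hamilton_corner A : A 0 2%:R = 0 -> cayley_hamilton A.
Proof.
move=> A02; have [A01 | b0] := eqVneq (A 0 1) 0; last first.
  have [A12 | f0] := eqVneq (A 1 2%:R) 0; first exact: cayley_hamilton_lblock21.
  exact: cayley_hamilton_generic.
have [A12 | f0] := eqVneq (A 1 2%:R) 0; last exact: cayley_hamilton_lblock12.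
have [A21 | h0] := eqVneq (A 2%:R 1) 0; first exact: cayley_hamilton_trig.
(* Swapping indices 1 and 2 keeps row 0 zero off the diagonal and moves the nonzero [A 2%:R 1] to
   position (1, 2). *)
pose s : 'S_3 := tperm 1 2%:R.
by apply: (@cayley_hamilton_mxsub _ _ s); apply: cayley_hamilton_lblock12; rewrite mxE !permE.
Qed.
End Main.

Theorem corollary6p5 (R : realType) (A : 'M[quat R]_3)
    (hA : exists i j : 'I_3, i != j /\ A i j = 0) :
  exists P : quat_poly R,
    characteristic_function (quat_poly_fun P) A /\ quat_poly_mx P A = 0.
Proof.
case: hA => x [y [xy Axy]].
(* [s] sends 0 to [x] and 2 to [y]; the first transposition leaves 0 fixed because [z != 0]. *)
pose z := tperm 0 x y; pose s : 'S_3 := mulg (tperm 2%:R z) (tperm 0 x).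
have z0 : z != 0 by rewrite -(tpermR 0 x) (inj_eq perm_inj) eq_sym.
apply: (@cayley_hamilton_mxsub _ _ s); apply: cayley_hamilton_corner.
by rewrite mxE !permM tpermL (@tpermD _ 2%:R) // tpermL /z tpermK.
Qed.
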